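(* On any Riemannian almost product $\mathcal{W}_3$-manifold $(M,P,g)\notin\mathcal{W}_0$ there exists a unique RPT-connection $\nabla'$ whose torsion is expressed by the tensor $F$. The following properties are valid for the torsion $T$ of $\nabla'$: $$T\in\mathcal{T}_2\oplus\mathcal{T}_3,\qquad T\notin\mathcal{T}_2,\qquad T\notin\mathcal{T}_3,$$ $$T(x,y,z)=\tfrac12\bigl\{F(x,y,Pz)+F(y,z,Px)+F(z,x,Py)\bigr\}$$ for all $x,y,z$.
   Context: A Riemannian almost product manifold $(M,P,g)$ is a differentiable manifold $M$ with a $(1,1)$-tensor field $P$ and a Riemannian metric $g$ such that $P^2x=x$, $g(Px,Py)=g(x,y)$; throughout $\mathrm{tr}\,P=0$. Here $x,y,z$ are arbitrary smooth vector fields on $M$ (or tangent vectors at a point). $\nabla$ is the Levi-Civita connection of $g$ and $F(x,y,z)=g((\nabla_xP)y,z)$. $(M,P,g)$ is a $\mathcal{W}_3$-manifold if $F(x,y,z)+F(y,z,x)+F(z,x,y)=0$ identically. The class $\mathcal{W}_0$ (the Riemannian $P$-manifolds) is determined by $\nabla P=0$, equivalently $F=0$. A linear connection $\nabla'$ is natural if $\nabla'P=\nabla'g=0$. Its torsion is $T(x,y)=\nabla'_xy-\nabla'_yx-[x,y]$, and $T(x,y,z)=g(T(x,y),z)$. An RPT-connection is a natural connection whose torsion $T(x,y,z)$ is totally skew-symmetric (a 3-form). The space $\mathcal{T}$ of $(0,3)$-tensors $T$ with $T(x,y,z)=-T(y,x,z)$ decomposes as $\mathcal{T}=\mathcal{T}_1\oplus\mathcal{T}_2\oplus\mathcal{T}_3\oplus\mathcal{T}_4$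 into invariant orthogonal subspaces, where $\mathcal{T}_i$ is the image of the projection operator $p_i$ defined by $p_1(x,y,z)=\frac18\{2T(x,y,z)-T(y,z,x)-T(z,x,y)-T(Pz,x,Py)+T(Py,z,Px)+T(z,Px,Py)-2T(Px,Py,z)+T(Py,Pz,x)+T(Pz,Px,y)-T(y,Pz,Px)\}$, $p_2(x,y,z)=\frac18\{2T(x,y,z)+T(y,z,x)+T(z,x,y)+T(Pz,x,Py)-T(Py,z,Px)-T(z,Px,Py)-2T(Px,Py,z)-T(Py,Pz,x)-T(Pz,Px,y)+T(y,Pz,Px)\}$, $p_3(x,y,z)=\frac14\{T(x,y,z)+T(Px,Py,z)-T(Px,y,Pz)-T(x,Py,Pz)\}$, $p_4(x,y,z)=\frac14\{T(x,y,z)+T(Px,Py,z)+T(Px,y,Pz)+T(x,Py,Pz)\}$. *)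

(* Defs.v *)
From HB Require Import structures.
From mathcomp Require Import all_boot all_order all_algebra.
From mathcomp Require Import all_classical all_reals topology normedtype derive.
From mathcomp Require Import ring.

Set Implicit Arguments.
Unset Strict Implicit.
Unset Printing Implicit Defensive.

Import Order.TTheory GRing.Theory Num.Theory numFieldNormedType.Exports.
Local Open Scope classical_set_scope.
Local Open Scope ring_scope.

Section Smooth.
Context {R : realType} {V W : normedModType R}.

(* For [U] open: all iterated directional derivatives up to order [k] exist and
   are continuous on [U]. *)
Fixpoint Ck (k : nat) (U : set V) (f : V -> W) : Prop :=
  (forall x, U x -> {for x, continuous f}) /\
  (if k is k'.+1 then
     forall v, (forall x, U x -> derivable f x v) /\ Ck k' U ('D_v f)
   else True).

Definition smooth_on (U : set V) (f : V -> W) : Prop := forall k, Ck k U f.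
End Smooth.

Section SmoothClosure.
Context {R : realType} {V : normedModType R}.
Implicit Types (U : set V) (f g : V -> R).

Lemma Ck_cont k U f x : Ck k U f -> U x -> {for x, continuous f}.
Proof. by case: k => [|k] [h _]; exact: h. Qed.

Lemma Ck_pred k U f : Ck k.+1 U f -> Ck k U f.
Proof.
elim: k f => [|k IH] f [fc fd]; first by split.
by split=> // v; have [dv cv] := fd v; split=> //; exact: IH.
Qed.

Lemma near_eq_open U f g x :
  open U -> (forall y, U y -> f y = g y) -> U x -> \near x, f x = g x.
Proof.
by move=> oU fg Ux; near=> y; apply: fg; near: y; exact: open_nbhs_nbhs.
Unshelve. all: by end_near. Qed.

Lemma Ck_eq k U f g : open U -> (forall x, U x -> f x = g x) ->
  Ck k U f -> Ck k U g.
Proof.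
move=> oU; elim: k f g => [|k IH] f g fg.
  move=> [fc _]; split=> // x Ux.
  have nfg := near_eq_open oU fg Ux.
  rewrite /prop_for /continuous_at -(fg _ Ux).
  by apply: cvg_trans (fc x Ux); apply: near_eq_cvg.
move=> fk; have [fc fd] := fk; split.
  move=> x Ux; have nfg := near_eq_open oU fg Ux.
  rewrite /prop_for /continuous_at -(fg _ Ux).
  by apply: cvg_trans (fc x Ux); apply: near_eq_cvg.
move=> v; have [dv cv] := fd v.
split=> [x Ux|].
  exact: near_eq_derivable (near_eq_open oU fg Ux) (dv x Ux).
apply: IH cv => x Ux.
exact: near_eq_derive (near_eq_open oU fg Ux).
Qed.

Lemma Ck_cst k U (a : R) : open U -> Ck k U (fun _ : V => a).
Proof.
move=> oU; elim: k a => [|k IH] a; split=> //; try by move=> x _; exact: cst_continuous.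
move=> v; split=> [x _|]; first exact: derivable_cst.
by apply: (Ck_eq oU _ (IH 0)) => x _; rewrite derive_cst.
Qed.

Lemma CkD k U f g : open U -> Ck k U f -> Ck k U g -> Ck k U (f \+ g).
Proof.
move=> oU; elim: k f g => [|k IH] f g [fc fd] [gc gd]; split=> //;
  try by move=> x Ux; apply: continuousD; [exact: fc|exact: gc].
move=> v; have [df cf] := fd v; have [dg cg] := gd v.
split=> [x Ux|]; first by apply: derivableD; [exact: df|exact: dg].
by apply: (Ck_eq oU _ (IH _ _ cf cg)) => x Ux /=; rewrite -(deriveD (df x Ux) (dg x Ux)).
Qed.

Lemma CkM k U f g : open U -> Ck k U f -> Ck k U g -> Ck k U (f \* g).
Proof.
move=> oU; elim: k f g => [|k IH] f g fk gk; have [fc fd] := fk; have [gc gd] := gk;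
  split=> //; try by move=> x Ux; apply: continuousM; [exact: fc|exact: gc].
move=> v; have [df cf] := fd v; have [dg cg] := gd v.
split=> [x Ux|]; first by apply: derivableM; [exact: df|exact: dg].
have := CkD oU (IH _ _ (Ck_pred fk) cg) (IH _ _ (Ck_pred gk) cf).
apply: (Ck_eq oU) => x Ux.
by rewrite deriveM//; [exact: df|exact: dg].
Qed.
End SmoothClosure.

Section Manifold.
Context {R : realType} {n : nat}.

Record chart (T : topologicalType) := Chart {
  chart_dom : set T;
  chart_map : T -> 'rV[R]_n;
  chart_inv : 'rV[R]_n -> T;
  chart_dom_open : open chart_dom;
  chart_cod_open : open (chart_map @` chart_dom);
  chart_mapK : {in chart_dom, cancel chart_map chart_inv};
  chart_map_cont : {within chart_dom, continuous chart_map};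
  chart_inv_cont : {within chart_map @` chart_dom, continuous chart_inv} }.

Definition smooth_transition (T : topologicalType) (c d : chart T) : Prop :=
  smooth_on (chart_map c @` (chart_dom c `&` chart_dom d))
    (chart_map d \o chart_inv c).
End Manifold.
Arguments chart R n T : clear implicits.
Arguments chart_cod_open {R n T} c.

(* The atlas need not be maximal: any smooth atlas determines the same smooth
   functions as the maximal atlas containing it. *)
Record manifold (R : realType) (n : nat) := Manifold {
  man_space :> topologicalType;
  man_hausdorff : hausdorff_space man_space;
  man_second_countable : @second_countable man_space;
  man_atlas : set (chart R n man_space);
  man_cover : forall p : man_space, exists2 c, man_atlas c & chart_dom c p;
  man_compat : forall c d, man_atlas c -> man_atlas d -> smooth_transition c d }.

Section SmoothFunctions.
Context {R : realType} {n : nat} (M : manifold R n).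

Definition is_smooth (f : M -> R) : Prop :=
  forall c, man_atlas c ->
    smooth_on (chart_map c @` chart_dom c) (f \o chart_inv c).

Definition smooth_pred : {pred M -> R} := fun f => `[< is_smooth f >].

Lemma smooth_mul f g :
  f \in smooth_pred -> g \in smooth_pred -> f * g \in smooth_pred.
Proof.
move=> /asboolP sf /asboolP sg; apply/asboolP => c Ac k.
exact: CkM (chart_cod_open c) (sf c Ac k) (sg c Ac k).
Qed.

Lemma smooth_cst (a : R) : (cst a : M -> R) \in smooth_pred.
Proof. by apply/asboolP => c Ac k; exact: Ck_cst (chart_cod_open c). Qed.

Lemma smooth_subring : subring_closed smooth_pred.
Proof.
split=> [|f g /asboolP sf sg|]; [exact: smooth_cst| |exact: smooth_mul].
have /asboolP sg' := smooth_mul (smooth_cst (-1)) sg.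
apply/asboolP => c Ac k.
have := CkD (chart_cod_open c) (sf _ Ac k) (sg' _ Ac k).
apply: (Ck_eq (chart_cod_open c)) => x _ /=.
by rewrite -[RHS]/(f _ - g _) -[in LHS]/(-1 * g _) mulN1r.
Qed.

Lemma smooth_scale : GRing.scaler_closed smooth_pred.
Proof. by move=> a f sf; exact: smooth_mul (smooth_cst a) sf. Qed.

HB.instance Definition _ := GRing.isSubringClosed.Build (M -> R) smooth_pred
  smooth_subring.
HB.instance Definition _ := GRing.isScaleClosed.Build R (M -> R) smooth_pred
  smooth_scale.

Record Cinf := MkCinf { Cinf_fun :> M -> R; _ : Cinf_fun \in smooth_pred }.
HB.instance Definition _ := [isSub for Cinf_fun].
HB.instance Definition _ := [Choice of Cinf by <:].
HB.instance Definition _ := 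
  GRing.SubChoice_isSubComPzRing.Build (M -> R) smooth_pred Cinf smooth_subring.
HB.instance Definition _ := [SubZmodule_isSubLmodule of Cinf by <:].
End SmoothFunctions.

Section VectorFields.
Context {R : realType} {n : nat} (M : manifold R n).

Definition is_derivation (D : Cinf M -> Cinf M) : Prop :=
  linear D /\ (forall f g, D (f * g) = f * D g + g * D f).
Definition derivation_pred : {pred Cinf M -> (Cinf M)^o} :=
  fun D => `[< is_derivation D >].

Lemma scaleoE (D : Cinf M -> (Cinf M)^o) (h f : Cinf M) : (h *: D) f = h * D f.
Proof. by []. Qed.

Lemma Cinf_scalerAr (a : R) (f g : Cinf M) : a *: (f * g) = f * (a *: g).
Proof. by apply/val_inj/funext => p /=; rewrite -[LHS]/(a * (f p * g p)) mulrCA. Qed.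

Lemma derivation_submod : submod_closed derivation_pred.
Proof.
split.
  apply/asboolP; split.
    move=> a f g.
    by rewrite -[LHS]/(0 : Cinf M) -[RHS]/(a *: 0 + 0 : Cinf M) scaler0 addr0.
  move=> f g.
  by rewrite -[LHS]/(0 : Cinf M) -[RHS]/(f * 0 + g * 0 : Cinf M) !mulr0 addr0.
move=> h D E /asboolP[Dl DL] /asboolP[El EL]; apply/asboolP; split.
  move=> a f g.
  rewrite -[LHS]/(h * D (a *: f + g) + E (a *: f + g) : Cinf M).
  rewrite -[RHS]/(a *: (h * D f + E f) + (h * D g + E g) : Cinf M).
  by rewrite Dl El mulrDr scalerDr Cinf_scalerAr addrACA.
move=> f g.
rewrite -[LHS]/(h * D (f * g) + E (f * g) : Cinf M).
rewrite -[RHS]/(f * (h * D g + E g) + g * (h * D f + E f) : Cinf M).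
by rewrite DL EL !mulrDr (mulrCA h f) (mulrCA h g) addrACA.
Qed.

HB.instance Definition _ :=
  GRing.isSubmodClosed.Build (Cinf M) (Cinf M -> (Cinf M)^o) derivation_pred
    derivation_submod.

(* Vector fields are the derivations of the real algebra of smooth functions;
   (0,k)- and (1,k)-tensor fields are the maps on vector fields that are
   multilinear over the smooth functions. *)
Record vfield := VField {
  vf_fun :> Cinf M -> (Cinf M)^o; _ : vf_fun \in derivation_pred }.
HB.instance Definition _ := [isSub for vf_fun].
HB.instance Definition _ := [Choice of vfield by <:].
HB.instance Definition _ := [SubChoice_isSubLmodule of vfield by <:].

Definition commutator (x y : vfield) : Cinf M -> (Cinf M)^o :=
  fun f => x (y f) - y (x f).

Lemma vfieldP (x : vfield) : is_derivation x.
Proof. by case: x => D hD; apply/asboolP. Qed.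

Lemma commutator_derivation (x y : vfield) : commutator x y \in derivation_pred.
Proof.
have [Dl DL] := vfieldP x; have [El EL] := vfieldP y.
set D := vf_fun x in Dl DL; set E := vf_fun y in El EL.
have DA f g : D (f + g) = D f + D g by have := Dl 1 f g; rewrite !scale1r.
have EA f g : E (f + g) = E f + E g by have := El 1 f g; rewrite !scale1r.
apply/asboolP; split => [a f g|f g] /=.
  rewrite -[LHS]/(D (E (a *: f + g)) - E (D (a *: f + g)) : Cinf M).
  rewrite -[RHS]/(a *: (D (E f) - E (D f)) + (D (E g) - E (D g)) : Cinf M).
  by rewrite El Dl Dl El scalerBr opprD addrACA.
rewrite -[LHS]/(D (E (f * g)) - E (D (f * g)) : Cinf M).
rewrite -[RHS]/(f * (D (E g) - E (D g)) + g * (D (E f) - E (D f)) : Cinf M).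
rewrite EL DL DA EA !DL !EL.
move: (D (E g)) (E (D g)) (D (E f)) (E (D f)) (D f) (E f) (D g) (E g).
by move=> a b c d e h u v; ring.
Qed.

Definition lie (x y : vfield) : vfield := VField (commutator_derivation x y).
End VectorFields.

Section Geometry.
Context {R : realType} {n : nat} (M : manifold R n).
Local Notation C := (Cinf M).
Local Notation X := (vfield M).
Implicit Types (x y z : X) (f : C) (p : M).

Definition tensor3 (T : X -> X -> X -> C) : Prop :=
  [/\ forall y z, scalar (fun x => T x y z),
      forall x z, scalar (fun y => T x y z) &
      forall x y, scalar (fun z => T x y z)].

(* [x_p = 0] in the tangent space at [p]. *)
Definition vanishes_at p x : Prop := forall f, x f p = 0.

Definition riemannian_metric (g : X -> X -> C) : Prop :=
  [/\ forall y, scalar (fun x => g x y),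
      forall x y, g x y = g y x,
      forall x p, 0 <= g x x p &
      forall x p, g x x p = 0 -> vanishes_at p x].

(* [(e_1)_p, ..., (e_n)_p] is a basis of the tangent space at [p]. *)
Definition tangent_basis p (e : 'I_n -> X) : Prop :=
  forall x, exists! a : 'rV[R]_n,
    forall f, x f p = \sum_(i < n) a 0 i * e i f p.

Definition trace_at (P : X -> X) p (t : R) : Prop :=
  exists (e : 'I_n -> X) (A : 'M[R]_n),
    [/\ tangent_basis p e,
        forall j f, P (e j) f p = \sum_(i < n) A i j * e i f p &
        t = \tr A].

Definition almost_product (P : {linear X -> X}) (g : X -> X -> C) : Prop :=
  [/\ riemannian_metric g,
      forall x, P (P x) = x,
      forall x y, g (P x) (P y) = g x y &
      forall p, trace_at P p 0].

Definition linear_connection (nabla : X -> X -> X) : Prop :=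
  [/\ forall y, linear (fun x => nabla x y),
      forall x y z, nabla x (y + z) = nabla x y + nabla x z &
      forall x f y, nabla x (f *: y) = x f *: y + f *: nabla x y].

Definition torsion (nabla : X -> X -> X) x y : X :=
  nabla x y - nabla y x - lie x y.

Definition metric_connection (g : X -> X -> C) (nabla : X -> X -> X) : Prop :=
  forall x y z, x (g y z) = g (nabla x y) z + g y (nabla x z).

Definition levi_civita (g : X -> X -> C) (nabla : X -> X -> X) : Prop :=
  [/\ linear_connection nabla, metric_connection g nabla &
      forall x y, torsion nabla x y = 0].

Definition cov (nabla : X -> X -> X) (P : X -> X) x y : X :=
  nabla x (P y) - P (nabla x y).

Definition natural_connection (P : X -> X) (g : X -> X -> C)
    (nabla : X -> X -> X) : Prop :=
  [/\ linear_connection nabla, forall x y, cov nabla P x y = 0 &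
      metric_connection g nabla].

Definition torsion3 (g : X -> X -> C) (nabla : X -> X -> X) x y z : C :=
  g (torsion nabla x y) z.

Definition skew12 (T : X -> X -> X -> C) : Prop :=
  forall x y z, T x y z = - T y x z.
Definition skew23 (T : X -> X -> X -> C) : Prop :=
  forall x y z, T x y z = - T x z y.

Definition RPT_connection (P : X -> X) (g : X -> X -> C)
    (nabla : X -> X -> X) : Prop :=
  [/\ natural_connection P g nabla, skew12 (torsion3 g nabla) &
      skew23 (torsion3 g nabla)].

Definition tensorF (P : X -> X) (g : X -> X -> C) (nabla : X -> X -> X)
    x y z : C := g (cov nabla P x y) z.

Definition W3 (F : X -> X -> X -> C) : Prop :=
  forall x y z, F x y z + F y z x + F z x y = 0.
Definition W0 (F : X -> X -> X -> C) : Prop :=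
  forall x y z, F x y z = 0.

Definition torsion_space (T : X -> X -> X -> C) : Prop :=
  tensor3 T /\ skew12 T.

Definition proj2 (P : X -> X) (T : X -> X -> X -> C) x y z : C :=
  (8^-1 : R) *:
    (T x y z *+ 2 + T y z x + T z x y + T (P z) x (P y)
     - T (P y) z (P x) - T z (P x) (P y) - T (P x) (P y) z *+ 2
     - T (P y) (P z) x - T (P z) (P x) y + T y (P z) (P x)).
Definition proj3 (P : X -> X) (T : X -> X -> X -> C) x y z : C :=
  (4^-1 : R) *:
    (T x y z + T (P x) (P y) z - T (P x) y (P z) - T x (P y) (P z)).

Definition in_T2 (P : X -> X) (T : X -> X -> X -> C) : Prop :=
  exists2 S, torsion_space S & forall x y z, T x y z = proj2 P S x y z.
Definition in_T3 (P : X -> X) (T : X -> X -> X -> C) : Prop :=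
  exists2 S, torsion_space S & forall x y z, T x y z = proj3 P S x y z.
Definition in_T2_plus_T3 (P : X -> X) (T : X -> X -> X -> C) : Prop :=
  exists T2 T3, [/\ in_T2 P T2, in_T3 P T3 &
    forall x y z, T x y z = T2 x y z + T3 x y z].

(* [T] is "expressed by [F]": it is a combination, with smooth (in particular
   constant) coefficients, of the tensors obtained from [F] by permuting its
   arguments and by inserting [P] in them. *)
Inductive expressed_by (P : X -> X) (F : X -> X -> X -> C) :
    (X -> X -> X -> C) -> Prop :=
| EB_base : expressed_by P F F
| EB_lin (f : C) S T : expressed_by P F S -> expressed_by P F T ->
    expressed_by P F (fun x y z => f * S x y z + T x y z)
| EB_swap T : expressed_by P F T -> expressed_by P F (fun x y z => T y x z)
| EB_cycle T : expressed_by P F T -> expressed_by P F (fun x y z => T y z x)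
| EB_P T : expressed_by P F T -> expressed_by P F (fun x y z => T (P x) y z).
End Geometry.

(* Main.v *)
Require Import Defs.
From HB Require Import structures.
From mathcomp Require Import all_boot all_order all_algebra.
From mathcomp Require Import all_classical all_reals topology normedtype derive.
From mathcomp Require Import ring.

Import GRing.Theory numFieldNormedType.Exports.
Local Open Scope ring_scope.

(* A connection preserving g with skew torsion T is nabla + T/2, so preserving P
   amounts to T(x,y,Pz) - T(x,Py,z) = 2 F(x,y,z).  This determines T up to a
   3-form supported on the triples taken from a single eigenspace of P.  Since
   F(x,.,.) vanishes on such pairs, a T expressed by F vanishes on such triples,
   hence 2 T(x,y,z) = F(x,y,Pz) + F(y,z,Px) + F(z,x,Py).  For existence, the W3
   identity turns F(z,x,Py) into -F(x,Py,z) - F(Py,z,x), so the right-hand side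
   is g(V(x,y),z) for an explicit V; no duality between vector fields and
   1-forms is needed.  T is nonzero because F is; if T were in T_2 or T_3, then
   T(Px,Py,z) would be -T(x,y,z) or T(x,y,z), which by the vanishing on
   single-eigenspace triples forces T = 0. *)

(** Linearity enters as bare propositions, as in [riemannian_metric]; bundling gives access to
    [linearD], [linearZ] and the like. *)
Lemma linear_for_bundle {K : pzRingType} {V : lmodType K} {W : zmodType}
    {s : GRing.Scale.law K W} {f : V -> W} :
  linear_for s f -> exists h : {linear V -> W | s}, f = h.
Proof.
move=> lf.
pose L := GRing.isLinear.Build K V W s f lf.
by exists (HB.pack_for {linear V -> W | s} f L).
Qed.

(** * Identities between F and a 3-form T *)

Section SkewTensors.
Context {X : Type} {C : comPzRingType}.

(** Twice the torsion that the theorem asserts. *)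
Definition torsionF (P : X -> X) (F : X -> X -> X -> C) x y z : C :=
  F x y (P z) + F y z (P x) + F z x (P y).

Context {P : X -> X} {F T : X -> X -> X -> C}.
Context (PK : forall x, P (P x) = x)
  (F_sym : forall x y z, F x y z = F x z y)
  (F_P : forall x y z, F x (P y) z = - F x y (P z))
  (F_W3 : forall x y z, F x y z + F y z x + F z x y = 0).

Lemma torsionF_skew12 x y z : torsionF P F x y z = - torsionF P F y x z.
Proof.
rewrite /torsionF (F_sym x z (P y)) (F_sym y x (P z)) (F_sym z y (P x)) !F_P.
by ring.
Qed.

Lemma torsionF_skew23 x y z : torsionF P F x y z = - torsionF P F x z y.
Proof.
rewrite /torsionF (F_sym x z (P y)) (F_sym y x (P z)) (F_sym z y (P x)) !F_P.
by ring.
Qed.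

(** The W3 identity enters twice: at [(x, y, z)] it removes [F z x y], at [(x, P y, P z)] it removes
    [F (P z) x (P y)]. *)
Lemma torsionF_P x y z :
  torsionF P F x y (P z) - torsionF P F x (P y) z = F x y z *+ 4.
Proof.
have F_PP a b c : F a (P b) (P c) = - F a b c by rewrite F_P PK.
have e1 : F z x y = - F x y z - F y z x.
  by apply/subr0_eq; rewrite -[RHS](F_W3 x y z); ring.
have e2 : F (P z) x (P y) = F x y z + F (P y) z (P x).
  have := F_W3 x (P y) (P z); rewrite F_PP (F_P (P y) z x) => h.
  by apply/subr0_eq; rewrite -[RHS]h; ring.
by rewrite /torsionF !PK !F_PP e2 e1; ring.
Qed.

Context (T_skew12 : forall x y z, T x y z = - T y x z)
  (T_skew23 : forall x y z, T x y z = - T x z y)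
  (T_P : forall x y z, T x y (P z) - T x (P y) z = F x y z *+ 2)
  (T_mixed : forall x y z,
     T x y z + T x (P y) (P z) + T (P x) y (P z) + T (P x) (P y) z = 0).

(** By [T_P] the left side is three copies of [T x y z] minus the three values with [P] in two
    slots; [T_mixed] makes these a fourth copy. *)
Lemma torsionF_mixed x y z : torsionF P F x y z *+ 2 = T x y z *+ 4.
Proof.
have cyc a b c : T a b c = T b c a by rewrite T_skew12 T_skew23 opprK.
have half a b c : F a b c *+ 2 = T a b (P c) - T a (P b) c by rewrite T_P.
rewrite /torsionF !mulrnDl !half !PK -(cyc x y z) (cyc z x y).
rewrite -(cyc (P x) y (P z)) (cyc z (P x) (P y)).
by rewrite -[RHS]subr0 -(T_mixed x y z); ring.
Qed.

End SkewTensors.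

(** * Clearing integer denominators in smooth functions *)

Section CinfScale.
Context {R : realType} {n : nat} {M : manifold R n}.

Lemma Cinf_scaleE (a : R) (f : Cinf M) : a *: f = (a *: (1 : Cinf M)) * f.
Proof. by rewrite mulrC -Cinf_scalerAr mulr1. Qed.

(** The form [k.+1] keeps the factor nonzero, so an argument 1, 3 or 7 clears a denominator 2, 4 or
    8. *)
Lemma Cinf_divn (k : nat) (f h : Cinf M) :
  f *+ k.+1 = h -> f = (k.+1%:R^-1 : R) *: h.
Proof.
move=> <-; rewrite -[f *+ _](@scaler_nat R) scalerA mulVf ?scale1r //.
by rewrite Num.Theory.pnatr_eq0.
Qed.

Lemma Cinf_mulrn_inj (k : nat) (f h : Cinf M) : f *+ k.+1 = h *+ k.+1 -> f = h.
Proof. by move=> /Cinf_divn ->; rewrite -(Cinf_divn k h _ erefl). Qed.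

End CinfScale.

(** * The metric on vector fields *)

Section MetricField.
Context {R : realType} {n : nat} {M : manifold R n}.
Context {g : vfield M -> vfield M -> Cinf M} (gR : riemannian_metric g).
Implicit Types u v w : vfield M.

Lemma metric_sym u v : g u v = g v u.
Proof. by case: gR. Qed.

Lemma metricPl w : scalar (g^~ w).
Proof. by case: gR. Qed.

Lemma metricDl u v w : g (u + v) w = g u w + g v w.
Proof. by have [h /funeqP e] := linear_for_bundle (metricPl w); rewrite !e linearD. Qed.

Lemma metricBl u v w : g (u - v) w = g u w - g v w.
Proof. by have [h /funeqP e] := linear_for_bundle (metricPl w); rewrite !e linearB. Qed.

Lemma metricNl u w : g (- u) w = - g u w.
Proof. by have [h /funeqP e] := linear_for_bundle (metricPl w); rewrite !e linearN. Qed.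

Lemma metricZl a u w : g (a *: u) w = a * g u w.
Proof. by have [h /funeqP e] := linear_for_bundle (metricPl w); rewrite !e linearZ. Qed.

Lemma metricDr u v w : g w (u + v) = g w u + g w v.
Proof. by rewrite metric_sym metricDl !(metric_sym w). Qed.

(** The hypothesis gives [g (u - v) (u - v) = 0], so by definiteness [u - v] vanishes at every
    point, hence as a derivation. *)
Lemma metric_inj u v : (forall w, g u w = g v w) -> u = v.
Proof.
move=> e; apply/val_inj/funext => f; apply/val_inj/funext => p /=.
have uv0 : vanishes_at p (u - v).
  have [_ _ _ gp] := gR; apply: gp.
  by rewrite metricBl e subrr.
exact/subr0_eq/uv0.
Qed.
End MetricField.


(* The sum vanishes identically iff T vanishes on all triples of vectors taken
   from one eigenspace of P. *)
Lemma expressed_by_mixed {R : realType} {n : nat} {M : manifold R n}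
    {P : vfield M -> vfield M} {F T : vfield M -> vfield M -> vfield M -> Cinf M} :
  (forall x, P (P x) = x) ->
  (forall x y z, F x (P y) z = - F x y (P z)) ->
  expressed_by P F T -> forall x y z,
  T x y z + T x (P y) (P z) + T (P x) y (P z) + T (P x) (P y) z = 0.
Proof.
move=> PK F_P; elim=> [|f S {}T _ IS _ IT|{}T _ IT|{}T _ IT|{}T _ IT] x y z.
- by rewrite !F_P PK; ring.
- transitivity (f * (S x y z + S x (P y) (P z) + S (P x) y (P z)
     + S (P x) (P y) z) + (T x y z + T x (P y) (P z) + T (P x) y (P z)
     + T (P x) (P y) z)); first by ring.
  by rewrite IS IT mulr0 addr0.
- by rewrite -[RHS](IT y x z); ring.
- by rewrite -[RHS](IT y z x); ring.
- by rewrite -[RHS](IT (P x) y z) PK; ring.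
Qed.

(** * 3-forms and the projections onto T_2 and T_3 *)

Section Projections.
Context {R : realType} {n : nat} {M : manifold R n}.
Context {P : vfield M -> vfield M} {T : vfield M -> vfield M -> vfield M -> Cinf M}.
Context (PK : forall x, P (P x) = x).

(** Replacing [x, y] by [P x, P y] permutes the terms of [proj2] with a change of sign; for [proj3]
    the sign is kept. *)
Lemma in_T2_PP : in_T2 P T -> forall x y z, T (P x) (P y) z = - T x y z.
Proof.
move=> [S _ TS] x y z; rewrite !TS /proj2 !PK -scalerN; congr (_ *: _); ring.
Qed.

Lemma in_T3_PP : in_T3 P T -> forall x y z, T (P x) (P y) z = T x y z.
Proof.
move=> [S _ TS] x y z; rewrite !TS /proj3 !PK; congr (_ *: _); ring.
Qed.

Context (T3 : tensor3 T) (T_skew12 : skew12 T) (T_skew23 : skew23 T).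
Context (T_mixed : forall x y z,
  T x y z + T x (P y) (P z) + T (P x) y (P z) + T (P x) (P y) z = 0).

Let cyc x y z : T x y z = T y z x.
Proof. by rewrite T_skew12 T_skew23 opprK. Qed.

(** On such a [T], [proj2] is half the difference of [T x y z] and [T (P x) (P y) z], and [proj3] is
    half their sum. *)
Lemma skew_mixed_T2_plus_T3 : in_T2_plus_T3 P T.
Proof.
exists (proj2 P T), (proj3 P T); split; [by exists T | by exists T |].
move=> x y z; apply: (Cinf_mulrn_inj 7).
have p2 : proj2 P T x y z *+ 8 = (T x y z - T (P x) (P y) z) *+ 4.
  rewrite /proj2 -[_ *+ 8](@scaler_nat R) scalerA divff ?scale1r;
    last by rewrite Num.Theory.pnatr_eq0.
  rewrite -(cyc x y z) (cyc z x y) (cyc (P z) x (P y)) -(cyc (P x) (P y) z).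
  rewrite (cyc z (P x) (P y)) -(cyc x (P y) (P z)) (cyc (P z) (P x) y).
  by rewrite -(cyc (P x) y (P z)); ring.
have p3 : proj3 P T x y z *+ 4 = (T x y z + T (P x) (P y) z) *+ 2.
  rewrite /proj3 -[_ *+ 4](@scaler_nat R) scalerA divff ?scale1r;
    last by rewrite Num.Theory.pnatr_eq0.
  by rewrite -[RHS]subr0 -(T_mixed x y z); ring.
by rewrite mulrnDl p2 [proj3 _ _ _ _ _ *+ 8](mulrnA _ 4 2) p3; ring.
Qed.

(** Cyclic invariance carries the sign rule to every pair of slots, so the mixed sum becomes
    [- 2 T x y z]. *)
Lemma skew_mixed_T2 : in_T2 P T -> forall x y z, T x y z = 0.
Proof.
move=> /in_T2_PP h x y z; apply: (Cinf_mulrn_inj 1).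
have a : T x (P y) (P z) = - T x y z by rewrite (cyc x) h -(cyc x).
have b : T (P x) y (P z) = - T x y z by rewrite -(cyc (P z)) h (cyc z).
by rewrite mul0rn -oppr0 -(T_mixed x y z) a b h; ring.
Qed.

(** Here all four terms of the mixed sum equal [T x y z]. *)
Lemma skew_mixed_T3 : in_T3 P T -> forall x y z, T x y z = 0.
Proof.
move=> /in_T3_PP h x y z; apply: (Cinf_mulrn_inj 3).
have a : T x (P y) (P z) = T x y z by rewrite (cyc x) h -(cyc x).
have b : T (P x) y (P z) = T x y z by rewrite -(cyc (P z)) h (cyc z).
by rewrite mul0rn -(T_mixed x y z) a b h; ring.
Qed.

End Projections.

(** * The candidate torsion as a tensor expressed by F *)

Lemma tensor3_scale {R : realType} {n : nat} {M : manifold R n} (c : R)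
    {T : vfield M -> vfield M -> vfield M -> Cinf M} :
  tensor3 T -> tensor3 (fun x y z => c *: T x y z).
Proof.
have scal (f : vfield M -> Cinf M) : scalar f -> scalar (fun x => c *: f x).
  by move=> lf a u v; rewrite lf scalerDr Cinf_scalerAr.
by move=> [T1 T2 T3]; split=> *; exact: scal.
Qed.

Section TorsionTensor.
Context {R : realType} {n : nat} {M : manifold R n}.
Context {P : {linear vfield M -> vfield M}}.
Context {F : vfield M -> vfield M -> vfield M -> Cinf M}.

Lemma tensor3_torsionF : tensor3 F -> tensor3 (torsionF P F).
Proof.
move=> [F1 F2 F3].
have F1' a u v y z : F (a *: u + v) y z = a * F u y z + F v y z by exact: F1.
have F2' a u v x z : F x (a *: u + v) z = a * F x u z + F x v z by exact: F2.
have F3' a u v x y : F x y (a *: u + v) = a * F x y u + F x y v by exact: F3.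
by split=> ? ? a u v; rewrite /torsionF !linearP F1' F2' F3'; ring.
Qed.

Lemma expressed_by_torsionF :
  expressed_by P F (fun x y z => (2^-1 : R) *: torsionF P F x y z).
Proof.
(* The zero tensor, obtained as [-F + F], ends the chain of [EB_lin] below. *)
have E0 : expressed_by P F (fun _ _ _ => 0).
  have := EB_lin (-1) (EB_base P F) (EB_base P F).
  congr (expressed_by _ _ _); apply/funext => x; apply/funext => y.
  by apply/funext => z; ring.
(* [EB_P] reaches the first slot only: one cycle brings the third slot there, two more return it. *)
have E1 : expressed_by P F (fun x y z => F x y (P z)).
  exact: EB_cycle (EB_cycle (EB_P (EB_cycle (EB_base P F)))).
have E2 := EB_cycle E1; have E3 := EB_cycle E2.
pose c : Cinf M := (2^-1 : R) *: (1 : Cinf M).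
have := EB_lin c E1 (EB_lin c E2 (EB_lin c E3 E0)).
congr (expressed_by _ _ _); apply/funext => x; apply/funext => y.
by apply/funext => z; rewrite Cinf_scaleE -/c /torsionF; ring.
Qed.

End TorsionTensor.

(** * The covariant derivative of P *)

Section Connections.
Context {R : realType} {n : nat} {M : manifold R n}.
Local Notation X := (vfield M).
Context {P : {linear X -> X}} {g : X -> X -> Cinf M}.

Lemma cov_linearl {D : X -> X -> X} y :
  linear_connection D -> linear (fun x => cov D P x y).
Proof.
move=> [Dl _ _] a u v; have e w : D (a *: u + v) w = a *: D u w + D v w.
  exact: Dl.
by rewrite /cov !e linearP scalerBr opprD addrACA.
Qed.

(** The two Leibniz terms [x a *: P u] cancel. *)
Lemma cov_linearr {D : X -> X -> X} x : linear_connection D -> linear (cov D P x).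
Proof.
move=> [_ DD DZ] a u v.
rewrite /cov linearP !DD !DZ linearD linearP [P (a *: _)]linearZ /=.
by rewrite scalerBr opprD addrACA opprD [in LHS](addrACA (x a *: _)) subrr add0r.
Qed.

Context (ap : almost_product P g).

Let gR : riemannian_metric g. Proof. by case: ap. Qed.
Let PK x : P (P x) = x. Proof. by case: ap => _ h _ _; exact: h. Qed.

Lemma metric_P x y : g (P x) y = g x (P y).
Proof. by case: ap => _ _ h _; rewrite -[RHS]h PK. Qed.

Lemma cov_P {D : X -> X -> X} x y : cov D P x (P y) = - P (cov D P x y).
Proof. by rewrite /cov linearB !PK opprB. Qed.

Context {nabla : X -> X -> X} (lc : levi_civita g nabla).
Local Notation F := (tensorF P g nabla).

(** This is self-adjointness of [P], differentiated along [x] by the metric property of [nabla]. *)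
Lemma tensorF_sym x y z : F x y z = F x z y.
Proof.
case: lc => _ mc _; rewrite /tensorF /cov !(metricBl gR) !metric_P.
have := mc x y (P z); have := mc x (P y) z.
rewrite (metric_P y z) => -> h.
have -> : g (nabla x (P y)) z = g (nabla x y) (P z) + g y (nabla x (P z)) - g (P y) (nabla x z).
  by apply/subr0_eq; rewrite -(subrr (g (nabla x y) (P z) + g y (nabla x (P z)))) -h; ring.
by rewrite metric_P (metric_sym gR y) (metric_sym gR y (P _)) metric_P; ring.
Qed.

Lemma tensorF_P x y z : F x (P y) z = - F x y (P z).
Proof. by rewrite /tensorF cov_P (metricNl gR) metric_P. Qed.

Lemma tensor3_tensorF : tensor3 F.
Proof.
have [lin _ _] := lc; split=> [y z|x z|x y] a u v; rewrite /tensorF.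
- by rewrite (cov_linearl y lin a u v) (metricDl gR) (metricZl gR).
- by rewrite (cov_linearr x lin a u v) (metricDl gR) (metricZl gR).
- by rewrite !(metric_sym gR (cov _ _ _ _)) (metricDl gR) (metricZl gR).
Qed.

(** * The torsion of an RPT-connection *)

Section RPT.
Context {D : X -> X -> X} (rpt : RPT_connection P g D).
Local Notation T := (torsion3 g D).

(** A Koszul-type argument: the difference [d] of the connections is skew in its last two slots, as
    both are metric, and [T] is [d] antisymmetrised in the first two. Hence
    [T x y z + T z x y - T y z x] is twice [d x y z], while for a 3-form it is [T x y z]. *)
Lemma RPT_torsion x y z : (g (D x y) z - g (nabla x y) z) *+ 2 = T x y z.
Proof.
have [[_ _ mD] s12 s23] := rpt; have [_ m0 t0] := lc.
have lieE u v : lie u v = nabla u v - nabla v u.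
  by have /subr0_eq := t0 u v.
pose d u v w := g (D u v) w - g (nabla u v) w.
have TE u v w : T u v w = d u v w - d v u w.
  by rewrite /torsion3 /torsion lieE !(metricBl gR) /d; ring.
have d23 u v w : d u v w = - d u w v.
  rewrite /d; apply/subr0_eq.
  have h : g (D u v) w + g v (D u w) = g (nabla u v) w + g v (nabla u w).
    by rewrite -mD -m0.
  by rewrite !(metric_sym gR _ v) -(subrr (g (D u v) w + g v (D u w))) {2}h; ring.
have -> : T x y z = T x y z + T z x y - T y z x.
  by rewrite [T z x y]s12 [T x z y]s23 [T y z x]s23 [T y x z]s12; ring.
rewrite !TE (d23 x z y) (d23 z y x) (d23 y z x) -/(d x y z) (d23 z x y).
by rewrite (d23 z y x); ring.
Qed.

(** [D] commutes with [P], so its terms cancel and those of [nabla] make up [F]. *)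
Lemma RPT_torsion_P x y z : T x y (P z) - T x (P y) z = F x y z *+ 2.
Proof.
have [[_ /(_ x y) /subr0_eq DP _] _ _] := rpt.
rewrite -!RPT_torsion DP metric_P /tensorF /cov (metricBl gR) metric_P; ring.
Qed.

Lemma RPT_expressed_torsion : expressed_by P F T ->
  forall x y z, T x y z = (2^-1 : R) *: torsionF P F x y z.
Proof.
have [_ s12 s23] := rpt; move=> TF x y z.
apply: (Cinf_divn 1); apply: (Cinf_mulrn_inj 1); rewrite -mulrnA.
apply/esym/(torsionF_mixed PK s12 s23 RPT_torsion_P).
exact: expressed_by_mixed PK tensorF_P TF.
Qed.

End RPT.

(* The W3 identity makes [contorsionF x y] dual to a quarter of
   [torsionF P F x y]; see [contorsionFE]. *)
Definition contorsionF x y : X :=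
  ((4^-1 : R) *: (1 : Cinf M)) *: (P (cov nabla P x y) + cov nabla P y (P x)
    - cov nabla P x (P y) - cov nabla P (P y) x).

(** * Existence under the W3 identity *)

Context (F_W3 : W3 F).

Lemma contorsionFE x y z : g (contorsionF x y) z *+ 4 = torsionF P F x y z.
Proof.
rewrite /contorsionF (metricZl gR) -Cinf_scaleE -[_ *+ 4](@scaler_nat R).
rewrite scalerA divff ?scale1r; last by rewrite Num.Theory.pnatr_eq0.
rewrite (metricBl gR _ (cov _ _ (P y) x)) (metricBl gR _ (cov _ _ x (P y))).
rewrite (metricDl gR (P _)) metric_P.
rewrite -/(F x y (P z)) -/(F y (P x) z) -/(F x (P y) z) -/(F (P y) x z).
rewrite (tensorF_sym y (P x) z) (tensorF_sym (P y) x z) /torsionF.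
(* The W3 identity at [(x, P y, z)] merges the two terms with a minus sign into [F z x (P y)]. *)
by rewrite -[RHS]subr0 -(F_W3 x (P y) z); ring.
Qed.

Definition rpt_connection x y : X := nabla x y + contorsionF x y.

(** Tested against [g], this becomes linearity of [torsionF] by [contorsionFE]. *)
Lemma contorsionF_linearl y : linear (contorsionF^~ y).
Proof.
have [T1 _ _] := tensor3_torsionF (P := P) tensor3_tensorF.
move=> a u v; apply: (metric_inj gR) => z; apply: (Cinf_mulrn_inj 3).
rewrite contorsionFE (metricDl gR) (metricZl gR) mulrnDl -mulrnAr !contorsionFE.
exact: T1.
Qed.

Lemma contorsionF_linearr x : linear (contorsionF x).
Proof.
have [_ T2 _] := tensor3_torsionF (P := P) tensor3_tensorF.
move=> a u v; apply: (metric_inj gR) => z; apply: (Cinf_mulrn_inj 3).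
rewrite contorsionFE (metricDl gR) (metricZl gR) mulrnDl -mulrnAr !contorsionFE.
exact: T2.
Qed.

Lemma rpt_connection_linear : linear_connection rpt_connection.
Proof.
have [[lin nD nZ] _ _] := lc; rewrite /rpt_connection.
split=> [y a u v|x y z|x f y].
- have e : nabla (a *: u + v) y = a *: nabla u y + nabla v y by exact: lin.
  by rewrite e contorsionF_linearl scalerDr addrACA.
- have := contorsionF_linearr x 1 y z; rewrite !scale1r => ->.
  by rewrite nD addrACA.
- have [h /funeqP e] := linear_for_bundle (contorsionF_linearr x).
  by rewrite nZ !e linearZ /= scalerDr addrA.
Qed.

Lemma rpt_connection_metric : metric_connection g rpt_connection.
Proof.
have [_ mc _] := lc; move=> x y z.
have h : g (contorsionF x y) z + g (contorsionF x z) y = 0.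
  apply: (Cinf_mulrn_inj 3); rewrite mulrnDl !contorsionFE mul0rn.
  by rewrite (torsionF_skew23 tensorF_sym tensorF_P) addNr.
rewrite mc /rpt_connection (metricDl gR) (metricDr gR).
by rewrite (metric_sym gR y (contorsionF _ _)) addrACA h addr0.
Qed.

(** By [torsionF_P] the contorsion contributes exactly [- F], cancelling the part of [nabla]. *)
Lemma rpt_connection_cov x y : cov rpt_connection P x y = 0.
Proof.
apply: (metric_inj gR) => z; apply: (Cinf_mulrn_inj 3).
rewrite /cov /rpt_connection linearD opprD addrACA -/(cov nabla P x y).
rewrite (metricDl gR) (metricBl gR (contorsionF _ _)) (metric_P (contorsionF _ _)).
rewrite mulrnDl mulrnBl !contorsionFE -/(F x y z) -(torsionF_P PK tensorF_P F_W3).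
by have [h /funeqP e] := linear_for_bundle (metricPl gR z); rewrite e linear0; ring.
Qed.

(** [nabla] has no torsion, and antisymmetrising a quarter of the skew [torsionF] doubles it. *)
Lemma rpt_connection_torsion :
  torsion3 g rpt_connection = fun x y z => (2^-1 : R) *: torsionF P F x y z.
Proof.
have [_ _ t0] := lc.
apply/funext => x; apply/funext => y; apply/funext => z.
apply: (Cinf_divn 1); apply: (Cinf_mulrn_inj 1); rewrite -mulrnA.
rewrite /torsion3 /torsion /rpt_connection.
have /subr0_eq <- := t0 x y.
have aux (a b c d : X) : a + b - (c + d) - (a - c) = b - d.
  by rewrite (opprD c) (addrACA a) (addrAC (a - c)) subrr add0r.
rewrite aux (metricBl gR) mulrnBl !contorsionFE.
by rewrite (torsionF_skew12 tensorF_sym tensorF_P y); ring.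
Qed.

Lemma rpt_connection_RPT : RPT_connection P g rpt_connection.
Proof.
rewrite /RPT_connection rpt_connection_torsion; split.
- split; [exact: rpt_connection_linear | exact: rpt_connection_cov |].
  exact: rpt_connection_metric.
- by move=> x y z; rewrite (torsionF_skew12 tensorF_sym tensorF_P) scalerN.
- by move=> x y z; rewrite (torsionF_skew23 tensorF_sym tensorF_P) scalerN.
Qed.

End Connections.

Theorem theorem2p3 (R : realType) (n : nat) (M : manifold R n)
    (P : {linear vfield M -> vfield M})
    (g : vfield M -> vfield M -> Cinf M)
    (nabla : vfield M -> vfield M -> vfield M) :
  almost_product P g ->
  levi_civita g nabla ->
  let F := tensorF P g nabla in
  W3 F -> ~ W0 F ->
  (exists! nabla' : vfield M -> vfield M -> vfield M,
     RPT_connection P g nabla' /\ expressed_by P F (torsion3 g nabla')) /\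
  (forall nabla' : vfield M -> vfield M -> vfield M,
     RPT_connection P g nabla' -> expressed_by P F (torsion3 g nabla') ->
     let T := torsion3 g nabla' in
     [/\ in_T2_plus_T3 P T,
         ~ in_T2 P T,
         ~ in_T3 P T &
         forall x y z : vfield M,
           T x y z =
           (2^-1 : R) *: (F x y (P z) + F y z (P x) + F z x (P y))]).
Proof.
move=> ap lc F w3 w0; have [gR PK _ _] := ap.
split.
  exists (rpt_connection (P := P) (nabla := nabla)); split.
    split; first exact: rpt_connection_RPT.
    by rewrite (rpt_connection_torsion ap lc w3); exact: expressed_by_torsionF.
  (* Uniqueness: both torsions equal the same formula in [F], and [RPT_torsion] recovers each
     connection from its torsion and [nabla]. *)
  move=> D [rpt TF]; apply/funext => x; apply/funext => y.
  apply: (metric_inj gR) => z; apply: (Cinf_mulrn_inj 1).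
  have := RPT_torsion ap lc (rpt_connection_RPT ap lc w3) x y z.
  rewrite (rpt_connection_torsion ap lc w3) -(RPT_expressed_torsion ap lc rpt TF).
  by rewrite -(RPT_torsion ap lc rpt) !mulrnBl => /addIr.
move=> D rpt TF; rewrite /=.
have [_ s12 s23] := rpt.
have TE := RPT_expressed_torsion ap lc rpt TF.
have mixed := expressed_by_mixed PK (tensorF_P ap) TF.
have T3 : tensor3 (torsion3 g D).
  have -> : torsion3 g D = fun x y z => (2^-1 : R) *: torsionF P F x y z.
    by apply/funext => x; apply/funext => y; apply/funext => z.
  exact/tensor3_scale/tensor3_torsionF/tensor3_tensorF.
(* By [RPT_torsion_P] a zero torsion would force [F = 0]; this excludes both T_2 and T_3. *)
have F0 : ~ (forall x y z, torsion3 g D x y z = 0).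
  move=> T0; apply: w0 => x y z; apply: (Cinf_mulrn_inj 1).
  by rewrite -(RPT_torsion_P ap lc rpt) !T0 subrr mul0rn.
split.
- exact: skew_mixed_T2_plus_T3.
- by move=> /(skew_mixed_T2 PK s12 s23 mixed).
- by move=> /(skew_mixed_T3 PK s12 s23 mixed).
- exact: TE.
Qed.
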